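(* Let $(\Xi,\mathcal F)$ be a measurable space, $\mathcal A$ a nonempty convex set of probability distributions on $(\Xi,\mathcal F)$, $S$ a closed convex subset of $\mathbb R^n$, $V$ a convex neighborhood of $S$, and $\varphi:\mathbb R^n\times\Xi\to\mathbb R$ a function. Assume that: (A1) for all $x\in V$ and $P\in\mathcal A$, the function $\xi\mapsto\varphi(x,\xi)$ is $\mathcal F$-measurable and $P$-integrable, i.e. $g(x,P):=\mathbb E_P[\varphi(x,\xi)]\in\mathbb R$; (A2) for all $\xi\in\Xi$, the function $x\mapsto\varphi(x,\xi)$ is convex on $V$; (A3) for all $x\in V$, $f(x):=\sup_{P\in\mathcal A}g(x,P)<+\infty$. Let $\mathcal T$ be a topology on $\mathcal A$ such that: (B1) $\mathcal A$ is sequentially compact; (B2) for every $x\in V$, the function $P\mapsto g(x,P)$ is continuous. Assume that $\bar x\in S$ is an optimal solution of the problem $$\inf_{x\in S}\sup_{P\in\mathcal A}\mathbb E_P[\varphi(x,\xi)]\equiv\inf_{x\in S}f(x).$$ Then this problem also admits a saddle point $(\bar x,\bar P)$ with $\bar P\in\mathcal A$, and the minimax equality $$\inf_{x\in S}\sup_{P\in\mathcal A}g(x,P)=\sup_{P\in\mathcal A}\inf_{x\in S}g(x,P)$$ holds.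
   Context: A pair $(\bar x,\bar P)\in S\times\mathcal A$ is a saddle point if $g(\bar x,P)\le g(\bar x,\bar P)\le g(x,\bar P)$ for all $x\in S$ and $P\in\mathcal A$. A neighborhood of $S$ is a set containing $S$ in its interior. *)

(* Defs.v *)
From HB Require Import structures.
From mathcomp Require Import all_boot all_order all_algebra.
From mathcomp Require Import all_classical all_reals all_analysis.

Set Implicit Arguments.
Unset Strict Implicit.
Unset Printing Implicit Defensive.

Import Order.TTheory GRing.Theory Num.Theory.
Import numFieldNormedType.Exports.

Local Open Scope classical_set_scope.
Local Open Scope ring_scope.

(* An arbitrary topology on the type X, as a variable.  The library record
   bundles, next to the open sets, a choice structure on X; it plays no role. *)
Definition topology_on (X : Type) : Type := Topological.axioms_ X.

Definition topologized (X : Type) (tau : topology_on X) : topologicalType :=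
  Topological.Pack tau.

Definition sequentially_compact (T : topologicalType) : Prop :=
  forall u : nat -> T, exists2 k : nat -> nat, increasing_seq k &
    exists l : T, u \o k @ \oo --> l.

Section distributions.
Context {d : measure_display} {Xi : measurableType d} {R : realType}.

(* In the library a probability is a function on all subsets of Xi, whose values
   are only meaningful on measurable sets.  Hence a mixture is characterized by
   its values on measurable sets, and a convex set is required to contain some
   representative of it. *)
Definition is_mixture (t : R) (P Q M : probability Xi R) : Prop :=
  forall B : set Xi, measurable B ->
    M B = (t%:E * P B + (1 - t)%:E * Q B)%E.

Definition convex_distributions (A : set (probability Xi R)) : Prop :=
  forall (t : R) (P Q : probability Xi R), 0 <= t <= 1 -> A P -> A Q ->
    exists2 M, A M & is_mixture t P Q M.

(* Expectations are extended-real in the library; fine is harmless because the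
   statement assumes integrability. *)
Definition expected_cost (n : nat) (phi : 'rV[R]_n -> Xi -> R)
    (x : 'rV[R]_n) (P : probability Xi R) : R :=
  fine 'E_P[phi x].

Definition worst_case_cost (n : nat) (phi : 'rV[R]_n -> Xi -> R)
    (A : set (probability Xi R)) (x : 'rV[R]_n) : \bar R :=
  ereal_sup [set (expected_cost phi x P)%:E | P in A].

End distributions.

Definition saddle_point (R : realType) (X Y : Type) (S : set X) (A : set Y)
    (g : X -> Y -> R) (xbar : X) (Pbar : Y) : Prop :=
  [/\ S xbar, A Pbar &
      forall x P, S x -> A P -> g xbar P <= g xbar Pbar <= g x Pbar].

(* Main.v *)
Require Import Defs.
From HB Require Import structures.
From mathcomp Require Import all_boot all_order all_algebra.
From mathcomp Require Import all_classical all_reals all_analysis.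
From mathcomp Require Import measurable_realfun ring lra.

Import Order.TTheory GRing.Theory Num.Theory.
Import numFieldNormedType.Exports.

Local Open Scope classical_set_scope.
Local Open Scope ring_scope.

(* Let v be the optimal value.  For finitely many points x_i of S, the convex set
   of vectors (g(x_i, P))_i meets every half-space [sum_i l_i y_i >= v - e] with
   convex weights l, because g(sum_i l_i x_i, P) <= sum_i l_i g(x_i, P); hence
   some P has g(x_i, P) >= v - e for all i.  Applying this along a countable dense
   sequence of S and extracting a convergent subsequence gives Pbar with
   g(x, Pbar) >= v on a dense subset of S, and then on all of S because the
   convex function g(., Pbar) is upper semicontinuous in the interior of V. *)

(** * Convex functions: Jensen's inequality and local upper bounds *)

Lemma convex_set_combo (R : realType) (E : lmodType R) (V : set E) (t : R) (x y : E) :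
  convex_set V -> 0 <= t <= 1 -> V x -> V y -> V (t *: x + (1 - t) *: y).
Proof.
move=> cV /andP[t0 t1] Vx Vy.
have := cV x y (Itv01 t0 t1); rewrite !inE; exact.
Qed.

Lemma convex_function_combo (R : realType) (E : lmodType R) (V : set E)
    (g : E -> R) (t : R) (x y : E) :
  convex_function V g -> 0 <= t <= 1 -> V x -> V y ->
  g (t *: x + (1 - t) *: y) <= t * g x + (1 - t) * g y.
Proof.
move=> cg /andP[t0 t1] Vx Vy.
have := cg (Itv01 t0 t1) x y; rewrite !inE; exact.
Qed.

(** Induction that splits off the first point. Membership is proved together with the inequality
    because the two-point convexity inequality requires the average [z] of the other points to lie
    in [V]. *)
Lemma convex_jensen (R : realType) (E : lmodType R) (V : set E) (g : E -> R)
    (m : nat) (l : 'I_m -> R) (x : 'I_m -> E) :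
  convex_set V -> convex_function V g ->
  (forall i, 0 <= l i) -> \sum_i l i = 1 -> (forall i, V (x i)) ->
  V (\sum_i l i *: x i) /\ g (\sum_i l i *: x i) <= \sum_i l i * g (x i).
Proof.
move=> cV cg; elim: m l x => [|m IH] l x l0.
  by rewrite big_ord0 => /esym/eqP; rewrite oner_eq0.
rewrite !big_ord_recl => l1 Vx.
set t := l ord0 in l1 *; set s := \sum_(i < m) _ in l1.
have t0 : 0 <= t by exact: l0.
have s0 : 0 <= s by apply: sumr_ge0.
have st : s = 1 - t by lra.
(* When [s = 0] the other weights cannot be renormalized, but then they all vanish. *)
have [s00|sn0] := eqVneq s 0.
  have lz i : l (lift ord0 i) = 0.
    by have /psumr_eq0P := s00; apply.
  have -> : t = 1 by lra.
  rewrite scale1r mul1r !big1 ?addr0// => i _; by rewrite lz ?scale0r ?mul0r.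
have [||i|Vz gz] := IH (fun i => l (lift ord0 i) / s) (fun i => x (lift ord0 i)).
- by move=> i; rewrite divr_ge0.
- by rewrite -mulr_suml divff.
- exact: Vx.
set z := \sum_i _ in Vz gz.
have -> : \sum_(i < m) l (lift ord0 i) *: x (lift ord0 i) = (1 - t) *: z.
  rewrite -st scaler_sumr; apply: eq_bigr => i _.
  by rewrite scalerA mulrC divfK.
have t01 : 0 <= t <= 1 by lra.
split; first exact: convex_set_combo.
apply: (le_trans (convex_function_combo _ _ _ _ _ _ _ cg t01 (Vx ord0) Vz)).
rewrite lerD2l -st.
apply: (le_trans (ler_wpM2l s0 gz)).
rewrite mulr_sumr le_eqVlt; apply/orP; left; apply/eqP; apply: eq_bigr => i _.
by rewrite mulrA mulrCA divff// mulr1.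
Qed.

(** For [t >= 0] the point lies between [x] and [x + v]. Adding both increments makes the bound
    symmetric in [v] and [- v], so negative [t] reduces to this case. *)
Lemma convex_segment_le (R : realType) (E : lmodType R) (V : set E) (g : E -> R)
    (x v : E) (t : R) :
  convex_set V -> convex_function V g ->
  V x -> V (x + v) -> V (x - v) -> `|t| <= 1 ->
  V (x + t *: v) /\
  g (x + t *: v) <= g x + `|t| * (`|g (x + v) - g x| + `|g (x - v) - g x|).
Proof.
move=> cV cg Vx; wlog t0 : v t / 0 <= t => [wl Vp Vn t1|Vp _].
  have [t0|/ltW t0] := leP 0 t; first exact: wl.
  have := wl (- v) (- t); rewrite oppr_ge0 scaleNr scalerN opprK normrN opprK => /(_ t0 Vn Vp t1).
  by rewrite addrC (addrC `|g (x - v) - g x|) addrC.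
rewrite ger0_norm// => t1.
have t01 : 0 <= t <= 1 by rewrite t0.
have -> : x + t *: v = t *: (x + v) + (1 - t) *: x.
  by rewrite scalerDr scalerBl scale1r [RHS]addrC addrA subrK.
split; first exact: convex_set_combo.
apply: (le_trans (convex_function_combo _ _ _ _ _ _ _ cg t01 Vp Vx)).
have := ler_norm (g (x + v) - g x); have := normr_ge0 (g (x - v) - g x).
set a := `| _ |; set b := `| _ |; nra.
Qed.

(** The values of [g] at the points [x ± r e_i] control it near [x]: a nearby [y] is an average of
    points on the axes through [x], at each of which the segment bound applies. *)
Lemma convex_upper_semicontinuous (R : realType) (n : nat) (V : set 'rV[R]_n)
    (g : 'rV[R]_n -> R) (x : 'rV[R]_n) (e : R) :
  convex_set V -> convex_function V g -> V° x -> 0 < e ->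
  \forall y \near x, g y <= g x + e.
Proof.
(* In dimension 0 there are no axes to average over, but all points coincide. *)
case: n V g x => [|n] V g x cV cg.
  by move=> _ e0; near=> y; rewrite [y]thinmx0 [x]thinmx0 lerDl ltW.
move=> /nbhs_ballP[r0 /= r00 xV] e0.
pose N : R := n.+1%:R.
have N0 : 0 < N by rewrite ltr0Sn.
pose r := r0 / 2.
have r_gt0 : 0 < r by rewrite divr_gt0.
have Vx : V x by apply: xV; exact: ballxx.
have Vv (s : R) (i : 'I_n.+1) : `|s| <= r -> V (x + s *: delta_mx 0 i).
  move=> sr; apply: xV; split => // j k; rewrite !mxE -ball_normE/= opprD addrA subrr.
  rewrite sub0r normrN normrM.
  by case: (_ && _); rewrite ?normr1 ?normr0 ?mulr1 ?mulr0//; apply: (le_lt_trans sr); rewrite /r; lra.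
pose B i := `|g (x + r *: delta_mx 0 i) - g x| + `|g (x - r *: delta_mx 0 i) - g x|.
have B0 i : 0 <= B i by rewrite addr_ge0.
pose M := \sum_i B i.
have M0 : 0 <= M by apply: sumr_ge0.
have BM i : B i <= M by rewrite /M (bigD1 i)//= lerDl sumr_ge0.
(* The first bound keeps the stretched points on the segments ([|s i| <= 1]); the second keeps the
   growth of [g] along them below [e]. *)
pose d := Num.min (r / N) (e * r / (N * (M + 1))).
have M1 : 0 < M + 1 by lra.
have d0 : 0 < d by rewrite lt_min !divr_gt0// ?mulr_gt0.
have dr : d * N <= r by rewrite -ler_pdivlMr// ge_min lexx.
have de : d * N * (M + 1) <= e * r.
  by rewrite -mulrA -ler_pdivlMr ?mulr_gt0// ge_min lexx orbT.
apply/nbhs_ballP; exists d => //= y [_ xy].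
(* y is the average of the n.+1 points of the coordinate axes through x obtained
   by stretching each coordinate of y - x by the factor n.+1. *)
pose s i := N * (y 0 i - x 0 i) / r.
have sd i : `|s i| <= N * d / r.
  rewrite normrM (gtr0_norm (_ : 0 < r^-1)) ?invr_gt0// ler_pM2r ?invr_gt0//.
  rewrite normrM (ger0_norm (ltW N0)) ler_pM2l// distrC ltW//.
  by have := xy 0 i; rewrite -ball_normE.
have s1 i : `|s i| <= 1.
  by apply: (le_trans (sd i)); rewrite ler_pdivrMr// mul1r mulrC.
have seg i := @convex_segment_le R _ V g x (r *: delta_mx 0 i) (s i) cV cg Vx.
have {}seg i : V (x + s i *: (r *: delta_mx 0 i)) /\
    g (x + s i *: (r *: delta_mx 0 i)) <= g x + e.
  have [||//|Vs gs] := seg i.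
  - by apply: Vv; rewrite ger0_norm// ltW.
  - by rewrite -scaleNr; apply: Vv; rewrite normrN ger0_norm// ltW.
  split=> //; apply: (le_trans gs); rewrite lerD2l -/(B i).
  apply: (@le_trans _ _ (N * d / r * (M + 1))).
    by apply: ler_pM => //; rewrite (le_trans (BM i))// lerDl.
  by rewrite mulrAC ler_pdivrMr// (mulrC N).
have [|||_] := @convex_jensen R _ V g n.+1 (fun=> N^-1)
  (fun i => x + s i *: (r *: delta_mx 0 i)) cV cg.
- by move=> i; rewrite invr_ge0 ltW.
- by rewrite sumr_const card_ord -[_ *+ _]mulr_natl divff// gt_eqF.
- by move=> i; have [] := seg i.
have -> : \sum_(i < n.+1) N^-1 *: (x + s i *: (r *: delta_mx 0 i)) = y.
  under eq_bigr do rewrite scalerDr.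
  rewrite big_split/= sumr_const card_ord -scaler_nat scalerA.
  rewrite divff ?gt_eqF// scale1r.
  rewrite -[RHS](subrK x) addrC; congr (_ + _).
  rewrite [RHS]row_sum_delta; apply: eq_bigr => i _.
  by rewrite !scalerA /s !mxE; congr (_ *: _); field; rewrite !gt_eqF.
move=> /le_trans; apply.
apply: (@le_trans _ _ (\sum_(i < n.+1) N^-1 * (g x + e))).
  by apply: ler_sum => i _; rewrite ler_pM2l ?invr_gt0//; have [] := seg i.
by rewrite sumr_const card_ord -[_ *+ _]mulr_natl mulrA divff ?mul1r// gt_eqF.
Unshelve. all: by end_near.
Qed.

(** * A minimax principle for finitely many functions *)

(* Minimizes the sum F of the squared positive parts of the [h i P]: were its
   infimum D positive, moving a near-minimizer P slightly towards the point Q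
   provided by the weights proportional to these positive parts would bring F
   below D. *)
Lemma finite_minimax (R : realType) (T : Type) (A : set T) (m : nat)
    (h : 'I_m -> T -> R) (C : R) :
  A !=set0 ->
  (forall t P Q, 0 <= t <= 1 -> A P -> A Q ->
     exists2 M, A M & forall i, h i M = t * h i P + (1 - t) * h i Q) ->
  (forall i P, A P -> `|h i P| <= C) ->
  (forall l : 'I_m -> R, (forall i, 0 <= l i) -> \sum_i l i = 1 ->
     forall e, 0 < e -> exists2 P, A P & \sum_i l i * h i P <= e) ->
  forall e, 0 < e -> exists2 P, A P & forall i, h i P <= e.
Proof.
move=> [P0 AP0] mix bnd sep e e0.
pose F P := \sum_i (Num.max (h i P) 0) ^+ 2.
have F0 P : 0 <= F P by apply: sumr_ge0 => i _; rewrite sqr_ge0.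
have FA0 : has_inf (F @` A).
  by split; [exists (F P0), P0 | exists 0 => _ [P _ <-]].
pose D := inf (F @` A).
have D0 : 0 <= D by apply: lb_le_inf => [|_ [P _ <-]//]; exists (F P0), P0.
have DF P : A P -> D <= F P by move=> AP; apply: (inf_lbound FA0.2); exists P.
have {D0} [D0|D0] := ltP 0 D; last first.
  (* If [D] vanishes, some [F P] is below [e ^+ 2], which forces each positive part below [e]. *)
  have [_ [P AP <-]] := @inf_adherent _ _ _ (exprn_gt0 2 e0) FA0.
  rewrite -/D => FP; exists P => // i; rewrite leNgt; apply/negP => eh.
  suff : e ^+ 2 <= F P by lra.
  rewrite /F (bigD1 i)//= ler_wpDr//; first by apply: sumr_ge0 => j _; rewrite sqr_ge0.
  by rewrite lerXn2r ?nnegrE ?le_max ?lexx ?orbT ?(ltW e0) ?(ltW eh).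
exfalso.
pose K := \sum_(i < m) (2 * C) ^+ 2.
have K0 : 0 <= K by apply: sumr_ge0 => i _; rewrite sqr_ge0.
(* With this [t] and a [P] within [t * D / 2] of the infimum, the first-order gain is at least
   [t * D] and the quadratic loss [t ^+ 2 * K] at most [t * D / 2], so [F M < D]. *)
pose t := D / (2 * (K + D)).
have KD0 : 0 < K + D by rewrite ltr_wpDl.
have tE : t * (2 * (K + D)) = D by rewrite /t divfK// mulf_neq0// gt_eqF.
have t0 : 0 < t by rewrite divr_gt0// mulr_gt0.
have t1 : t <= 1 by rewrite ler_pdivrMr ?mulr_gt0//; lra.
have tK : t * K <= D / 2 by nra.
have tD0 : 0 < t * D / 2 by rewrite divr_gt0// mulr_gt0.
have [_ [P AP <-]] := inf_adherent tD0 FA0; rewrite -/D => FP.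
pose l i := Num.max (h i P) 0.
have l0 i : 0 <= l i by rewrite le_max lexx orbT.
have lh i : l i * h i P = l i ^+ 2.
  by rewrite /l; case: (leP (h i P) 0) => _; rewrite ?mul0r ?expr0n ?expr2.
pose L := \sum_i l i.
have L0 : 0 < L.
  rewrite lt_neqAle sumr_ge0 ?andbT//; apply/negP => /eqP/esym/psumr_eq0P l00.
  suff : F P = 0 by have := DF P AP; lra.
  by apply: big1 => i _; rewrite -/(l i) l00// expr0n.
have [|||Q AQ lQ] := sep (fun i => l i / L) _ _ (D / 2 / L).
- by move=> i; rewrite divr_ge0// ltW.
- by rewrite -mulr_suml divff// gt_eqF.
- by rewrite !divr_gt0.
have {}lQ : \sum_i l i * h i Q <= D / 2.
  move: lQ; rewrite ler_pdivlMr// mulr_suml.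
  by under eq_bigr do rewrite mulrAC divfK ?gt_eqF//.
have [|M AM hM] := mix t Q P _ AQ AP; first by rewrite t1 ltW.
have : F M <= F P + 2 * t * (\sum_i l i * h i Q - F P) + t ^+ 2 * K.
  have {2}-> : F P = \sum_i l i * h i P by apply: eq_bigr => i _; rewrite lh.
  rewrite -sumrB mulr_sumr mulr_sumr -!big_split/=; apply: ler_sum => i _.
  rewrite hM -/(l i).
  have hb : (h i Q - h i P) ^+ 2 <= (2 * C) ^+ 2.
    rewrite -(real_normK (num_real (h i Q - h i P))) lerXn2r ?nnegrE//.
      by have := le_trans (normr_ge0 _) (bnd i _ AP); lra.
    by have := ler_normB (h i Q) (h i P); have := bnd i _ AP; have := bnd i _ AQ; lra.
  have hl : h i P <= l i by rewrite le_max lexx.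
  (* Completing the square: as [h i P <= l i], the positive part of [h i M] is at most
     [|l i + t * (h i Q - h i P)|]. *)
  have -> : l i ^+ 2 + 2 * t * (l i * h i Q - l i * h i P) + t ^+ 2 * (2 * C) ^+ 2 =
     (l i + t * (h i Q - h i P)) ^+ 2
       + t ^+ 2 * ((2 * C) ^+ 2 - (h i Q - h i P) ^+ 2).
    by ring.
  rewrite ler_wpDr//; first by apply: mulr_ge0; rewrite ?sqr_ge0 ?subr_ge0.
  have -> : t * h i Q + (1 - t) * h i P = h i P + t * (h i Q - h i P) by ring.
  case: (leP (h i P + t * (h i Q - h i P)) 0) => c; first by rewrite expr0n sqr_ge0.
  by rewrite lerXn2r ?nnegrE; nra.
have := DF M AM; have := DF P AP.
set q := \sum_i _ in lQ *.
nra.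
Qed.

(** * Sequential compactness and dense sequences *)

Lemma increasing_seq_cvg (k : nat -> nat) : increasing_seq k -> k @ \oo --> \oo.
Proof.
move=> /increasing_seqP kS; have kge m : (m <= k m)%N.
  by elim: m => // m IH; apply: leq_ltn_trans IH _; exact: kS.
move=> U [N _ NU]; exists N => //= m Nm; apply: NU => /=.
exact: leq_trans Nm (kge m).
Qed.

Lemma sequentially_compact_bounded (R : realType) (T : topologicalType) (f : T -> R) :
  sequentially_compact T -> continuous f -> exists C, forall t, `|f t| <= C.
Proof.
move=> cT cf; apply: contrapT => /forallNP ub.
have /choice[u hu] m : exists t, m%:R < `|f t|.
  by apply: contrapT => /forallNP fm; apply: (ub m%:R) => t; rewrite leNgt; apply/negP.
have [k /increasing_seq_cvg ki [l ukl]] := cT u.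
have fl : (f \o (u \o k)) @ \oo --> f l by apply: cvg_comp ukl (cf l).
have fb : \forall m \near \oo, `|f (u (k m))| <= `|f l| + 1.
  by apply: (cvgr_norm_le _ fl); rewrite ltrDl.
have kb : \forall m \near \oo, `|f l| + 1 <= (k m)%:R.
  exact: (ki _ (nbhs_infty_ger _)).
have [m [fm km]] := filter_ex (filterI fb kb).
by have := hu (k m); rewrite ltNge (le_trans fm).
Qed.

(** Pick [u m] satisfying the first [m] constraints with slack [1/(m+1)]. Along a convergent
    subsequence each fixed constraint holds eventually, and its slack tends to 0. *)
Lemma sequentially_compact_countable_ge (R : realType) (T : topologicalType)
    (f : nat -> T -> R) (v : R) :
  sequentially_compact T -> (forall i, continuous (f i)) ->
  (forall m e, 0 < e -> exists t, forall i, (i < m)%N -> v - e <= f i t) ->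
  exists t, forall i, v <= f i t.
Proof.
move=> cT cf fin.
have /choice[u hu] m : exists t, forall i, (i < m)%N -> v - m.+1%:R^-1 <= f i t.
  by apply: fin; rewrite invr_gt0.
have [k /increasing_seq_cvg ki [l ukl]] := cT u.
exists l => i; apply/ler_addgt0Pr => e e0; rewrite -lerBlDr.
have fl : (f i \o (u \o k)) @ \oo --> f i l by apply: cvg_comp ukl (cf i l).
apply: (cvgr_to_ge fl).
have ke := ki _ (near_infty_natSinv_lt (PosNum e0)).
have kI := ki _ (nbhs_infty_gt i).
near=> m; have km : (k m).+1%:R^-1 < e by near: m.
apply: (@le_trans _ _ (v - (k m).+1%:R^-1)); first by rewrite lerD2l lerN2 ltW.
by apply: hu; near: m.
Unshelve. all: by end_near.
Qed.

(** Rational points may miss [S], so each cube with rational centre and radius [1/(m+1)] contributes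
    a point of [S] inside it, or the default [x0] when it does not meet [S]. *)
Lemma exists_dense_sequence (R : realType) (n : nat) (S : set 'rV[R]_n) :
  S !=set0 -> exists u : nat -> 'rV[R]_n, (forall k, S (u k)) /\
    forall x U, S x -> nbhs x U -> exists k, U (u k).
Proof.
move=> [x0 Sx0].
pose near (p : 'rV[rat]_n * nat) (y : 'rV[R]_n) :=
  S y /\ forall j, `|ratr (p.1 0 j) - y 0 j| < p.2.+1%:R^-1.
have /choice[w hw] p : exists y, S y /\ ((exists z, near p z) -> near p y).
  have [[z pz]|np] := pselect (exists z, near p z); last by exists x0.
  by exists z; split=> //; case: pz.
pose u k := if unpickle k is Some p then w p else x0.
exists u; split=> [k|x U Sx /nbhs_ballP[e /= e0 xU]].
  by rewrite /u; case: unpickle => // p; have [] := hw p.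
have e20 : 0 < e / 2 by rewrite divr_gt0.
have [m hm] := filter_ex (near_infty_natSinv_lt (PosNum e20)).
rewrite /= in hm.
have /choice[q hq] (j : 'I_n) : exists q : rat, `|ratr q - x 0 j| < m.+1%:R^-1.
  have [|q] := @rat_in_itvoo R (x 0 j - m.+1%:R^-1) (x 0 j + m.+1%:R^-1).
    by rewrite ltrD2l gtrN// invr_gt0.
  rewrite in_itv/= => qx; exists q; rewrite ltr_norml.
  by move: (ratr q) (m.+1%:R^-1) qx => a b; lra.
pose p := (\row_j q j, m).
(* [x] itself shows that this cube meets [S]; the chosen point is then within [2/(m+1) < e] of
   [x]. *)
have px : near p x by split=> // j; rewrite mxE.
exists (pickle p); rewrite /u pickleK.
have [_ /(_ (ex_intro _ x px))[_ wp]] := hw p.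
apply: xU; split=> // i j; rewrite ord1 -ball_normE/=.
have := wp j; have := hq j; rewrite mxE !ltr_norml.
by move: (ratr (q j)) (m.+1%:R^-1) hm => a b; lra.
Qed.

(** * Expectations: affine in the distribution, convex in the decision *)

(** On measurable sets [M] agrees with a sum of scaled measures, and the integral sees only these
    values. *)
Lemma ge0_integral_mixture (d : measure_display) (Xi : measurableType d) (R : realType)
    (t : R) (P Q M : probability Xi R) (f : Xi -> \bar R) :
  0 <= t <= 1 -> is_mixture t P Q M ->
  measurable_fun [set: Xi] f -> (forall xi, 0 <= f xi)%E ->
  (\int[M]_xi f xi = t%:E * \int[P]_xi f xi + (1 - t)%:E * \int[Q]_xi f xi)%E.
Proof.
move=> /andP[t0 t1] mM mf f0; have t1' : 0 <= 1 - t by rewrite subr_ge0.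
rewrite (@eq_measure_integral _ _ _ _
  (measure_add (mscale (NngNum t0) P) (mscale (NngNum t1') Q))); last first.
  by move=> B mB _; apply: (eq_trans (mM B mB)); apply/esym; exact: measure_addE.
by rewrite ge0_integral_measure_add// !ge0_integral_mscale.
Qed.

Lemma Rintegral_mixture (d : measure_display) (Xi : measurableType d) (R : realType)
    (t : R) (P Q M : probability Xi R) (f : Xi -> R) :
  0 <= t <= 1 -> is_mixture t P Q M ->
  P.-integrable [set: Xi] (EFin \o f) -> Q.-integrable [set: Xi] (EFin \o f) ->
  \int[M]_xi f xi = t * \int[P]_xi f xi + (1 - t) * \int[Q]_xi f xi.
Proof.
move=> t01 mM iP iQ; have mf := measurable_int _ iP.
rewrite /Rintegral !(integralE _ _ (fun x => (f x)%:E)).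
rewrite !(ge0_integral_mixture _ _ _ _ _ _ _ _ t01 mM)//; last 2 first.
  exact: measurable_funeneg.
  exact: measurable_funepos.
have := integrable_pos_fin_num measurableT iP.
have := integrable_neg_fin_num measurableT iP.
have := integrable_pos_fin_num measurableT iQ.
have := integrable_neg_fin_num measurableT iQ.
rewrite /comp.
(* Integrability makes the four integrals of positive and negative parts finite, so the identity
   becomes one between reals. *)
move: (\int[P]_x _)%E (\int[P]_x _)%E (\int[Q]_x _)%E (\int[Q]_x _)%E.
move=> [a| |] [b| |] [c| |] [e| |] //= _ _ _ _; ring.
Qed.

Lemma expected_costE (d : measure_display) (Xi : measurableType d) (R : realType)
    (n : nat) (phi : 'rV[R]_n -> Xi -> R) (x : 'rV[R]_n) (P : probability Xi R) :
  expected_cost phi x P = \int[P]_xi phi x xi.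
Proof. by rewrite /expected_cost unlock. Qed.

Lemma expected_cost_convex (d : measure_display) (Xi : measurableType d) (R : realType)
    (n : nat) (V : set 'rV[R]_n) (phi : 'rV[R]_n -> Xi -> R) (P : probability Xi R) :
  convex_set V -> (forall x, V x -> P.-integrable [set: Xi] (EFin \o phi x)) ->
  (forall xi, convex_function V (fun x => phi x xi)) ->
  convex_function V (fun x => expected_cost phi x P).
Proof.
move=> cV iP cphi t x y Vx Vy; have Vz := cV x y t Vx Vy.
rewrite !inE in Vx Vy Vz; rewrite convRE !expected_costE -!RintegralZl//; try exact: iP.
have iZ (r : R) z : V z -> P.-integrable setT (EFin \o (fun xi => r * phi z xi)).
  by move=> Vz'; exact: (integrableZl measurableT r (iP z Vz')).
rewrite -RintegralD//; [|exact: iZ..].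
apply: le_Rintegral => //; first exact: iP.
  exact: (integrableD measurableT (iZ _ _ Vx) (iZ _ _ Vy)).
by move=> xi _; have := cphi xi t x y; rewrite !inE; exact.
Qed.

(** * The saddle point and the minimax equality *)

Theorem theoremA7
  (R : realType) (d : measure_display) (Xi : measurableType d)
  (A : set (probability Xi R)) (n : nat) (S V : set 'rV[R]_n)
  (phi : 'rV[R]_n -> Xi -> R) (tau : topology_on (set_type A))
  (xbar : 'rV[R]_n)
  (A_nonempty : A !=set0)
  (A_convex : convex_distributions A)
  (S_closed : closed S)
  (S_convex : convex_set S)
  (V_convex : convex_set V)
  (V_nbhd_S : S `<=` V°)
  (A1 : forall x P, V x -> A P ->
     measurable_fun [set: Xi] (phi x) /\
     P.-integrable [set: Xi] (EFin \o phi x))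
  (A2 : forall xi : Xi, convex_function V (fun x => phi x xi))
  (A3 : forall x, V x -> (worst_case_cost phi A x < +oo)%E)
  (B1 : sequentially_compact (topologized tau))
  (B2 : forall x, V x ->
     continuous (fun P : topologized tau => expected_cost phi x (set_val P)))
  (xbar_S : S xbar)
  (xbar_optimal : forall x, S x ->
     (worst_case_cost phi A xbar <= worst_case_cost phi A x)%E) :
  (exists Pbar : probability Xi R,
     saddle_point S A (expected_cost phi) xbar Pbar) /\
  ereal_inf [set ereal_sup [set (expected_cost phi x P)%:E | P in A] | x in S]
  = ereal_sup [set ereal_inf [set (expected_cost phi x P)%:E | x in S] | P in A].
Proof.
pose g := expected_cost phi.
have SV x : S x -> V x by move=> /V_nbhd_S; exact: interior_subset.
have [P0 AP0] := A_nonempty.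
have Wge x P : A P -> ((g x P)%:E <= worst_case_cost phi A x)%E.
  by move=> AP; apply: ereal_sup_ubound; exists P.
have [v Wv] : exists v, worst_case_cost phi A xbar = v%:E.
  have := Wge xbar _ AP0; have := A3 _ (SV _ xbar_S).
  by case: worst_case_cost => // r _ _; exists r.
have opt x : S x -> forall e, 0 < e -> exists2 P, A P & v - e <= g x P.
  move=> Sx e e0; have : ((v - e)%:E < worst_case_cost phi A x)%E.
    by apply: lt_le_trans (xbar_optimal x Sx); rewrite Wv lte_fin gtrBl.
  by move=> /ereal_sup_gt[_ [P AP <-]]; rewrite lte_fin => /ltW; exists P.
have gconv P : A P -> convex_function V (g ^~ P).
  by move=> AP; apply: expected_cost_convex => // x Vx; have [] := A1 x P Vx AP.
have gmix x t P Q M : V x -> 0 <= t <= 1 -> A P -> A Q -> is_mixture t P Q M ->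
    g x M = t * g x P + (1 - t) * g x Q.
  move=> Vx t01 AP AQ mM; rewrite /g !expected_costE.
  by apply: Rintegral_mixture => //; [have [] := A1 x P Vx AP|have [] := A1 x Q Vx AQ].
(* [finite_minimax] is applied to the deficits [v - g (y i) P], bounded on [A] by sequential
   compactness. *)
have fin m (y : 'I_m -> 'rV[R]_n) : (forall i, S (y i)) -> forall e, 0 < e ->
    exists2 P, A P & forall i, v - e <= g (y i) P.
  move=> Sy e e0.
  have /choice[c hc] i : exists c, forall P, A P -> `|v - g (y i) P| <= c.
    have [c hc] := sequentially_compact_bounded _ _ _ B1 (B2 _ (SV _ (Sy i))).
    exists (`|v| + c) => P AP; apply: (le_trans (ler_normB _ _)).
    by rewrite lerD2l; exact: (hc (exist _ P (mem_set AP))).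
  have c0 i : 0 <= c i by exact: le_trans (normr_ge0 _) (hc i P0 AP0).
  have [|||P AP hP] := @finite_minimax R _ A m (fun i P => v - g (y i) P)
      (\sum_i c i) A_nonempty _ _ _ e e0.
  - move=> t P Q t01 AP AQ; have [M AM mM] := A_convex t P Q t01 AP AQ.
    exists M => // i; rewrite (gmix _ t P Q)//; [ring|exact: SV].
  - move=> i P AP; apply: (le_trans (hc i P AP)).
    by rewrite (bigD1 i)//= lerDl sumr_ge0.
  - move=> l l0 l1 e' e'0.
    have Sz : S (\sum_i l i *: y i).
      (* Jensen for the zero function, used only for membership in [S]. *)
      have [|//] := @convex_jensen R _ S (fun=> 0) m l y S_convex _ l0 l1 Sy.
      by move=> t a b _ _; rewrite convRE !mulr0 addr0.
    have [P AP gP] := opt _ Sz e' e'0; exists P => //.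
    (* The averaged deficit is at most the deficit at the averaged point, where optimality of [xbar]
       supplies [P]. *)
    have [_ gz] := convex_jensen _ _ _ _ _ l y V_convex (gconv P AP) l0 l1
      (fun i => SV _ (Sy i)).
    under eq_bigr do rewrite mulrBr.
    by rewrite sumrB -mulr_suml l1 mul1r lerBlDl -lerBlDr (le_trans gP).
  - by exists P => // i; have := hP i; lra.
have [u [Su udense]] := exists_dense_sequence _ _ _ (ex_intro _ xbar xbar_S).
have [p hp] : exists p : topologized tau, forall i, v <= g (u i) (set_val p).
  apply: (@sequentially_compact_countable_ge R (topologized tau)
    (fun i p => g (u i) (set_val p)) v B1).
    by move=> i; apply: B2; exact: SV.
  move=> m e e0; have [P AP hP] := fin m (fun i => u i) (fun i => Su i) e e0.
  by exists (exist _ P (mem_set AP)) => i im; exact: (hP (Ordinal im)).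
set Pbar := set_val p in hp; have APbar : A Pbar by exact: set_valP.
have vle x : S x -> v <= g x Pbar.
  move=> Sx; apply/ler_addgt0Pr => e e0.
  (* Some [u k] falls in the neighborhood where [g y Pbar <= g x Pbar + e], and there
     [v <= g (u k) Pbar]. *)
  have := convex_upper_semicontinuous _ _ _ _ x e V_convex (gconv _ APbar) (V_nbhd_S _ Sx) e0.
  by move=> /(udense x _ Sx)[k]; exact: le_trans.
have gle P : A P -> g xbar P <= v by move=> AP; rewrite -lee_fin -Wv Wge.
split.
  (* The value [v] separates every [g xbar P] from every [g x Pbar], hence equals [g xbar Pbar]. *)
  exists Pbar; split=> // x P Sx AP; apply/andP; split.
    exact: le_trans (gle P AP) (vle _ xbar_S).
  exact: le_trans (gle _ APbar) (vle x Sx).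
apply/eqP; rewrite eq_le; apply/andP; split.
  apply: (@le_trans _ _ v%:E).
    by apply: ereal_inf_lbound; exists xbar.
  apply: (@le_trans _ _ (ereal_inf [set (expected_cost phi x Pbar)%:E | x in S])).
    by apply: le_ereal_inf_tmp => _ [x Sx <-]; rewrite lee_fin vle.
  by apply: ereal_sup_ubound; exists Pbar.
(* Weak duality: the inequality that holds for any payoff. *)
apply: ge_ereal_sup => _ [P AP <-]; apply: le_ereal_inf_tmp => _ [x Sx <-].
by apply: (le_trans _ (Wge x P AP)); apply: ereal_inf_lbound; exists x.
Qed.
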